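(* Let $X_{\lambda_1},X_{\lambda_2}$ be independent random variables with $X_{\lambda_i}\sim W(\alpha,\lambda_i)$, where $\lambda_i>0$, $i=1,2$, and let $X_{\theta_1},X_{\theta_2}$ be independent random variables with $X_{\theta_i}\sim W(\alpha,\theta_i)$, where $\theta_i>0$, $i=1,2$. Let $X_{2:2}^{\lambda}=\max(X_{\lambda_1},X_{\lambda_2})$ and $X_{2:2}^{\theta}=\max(X_{\theta_1},X_{\theta_2})$. Then, for $0<\alpha\le 1$, $$(\lambda_1,\lambda_2)\preceq^{m}(\theta_1,\theta_2)\ \Rightarrow\ X_{2:2}^{\lambda}\le_{lr}X_{2:2}^{\theta}.$$
   Context: Weibull distribution: $X\sim W(\alpha,\lambda)$ (shape $\alpha>0$, parameter $\lambda>0$) means $X$ has density $f(t)=\alpha\lambda(\lambda t)^{\alpha-1}e^{-(\lambda t)^{\alpha}}$ for $t>0$, i.e. distribution function $1-e^{-(\lambda t)^{\alpha}}$ for $t>0$. ''Increasing'' means non-decreasing. Majorization: for $x,y\in\mathbb{R}^n$ with increasing arrangements $x_{(1)}\le\cdots\le x_{(n)}$ and $y_{(1)}\le\cdots\le y_{(n)}$, $x\preceq^{m}y$ means $\sum_{i=1}^{j}x_{(i)}\ge\sum_{i=1}^{j}y_{(i)}$ for $j=1,\ldots,n-1$ and $\sum_{i=1}^{n}x_{(i)}=\sum_{i=1}^{n}y_{(i)}$. Likelihood ratio order: for random variables $X,Y$ with densities $f,g$, $X\le_{lr}Y$ means that $g(t)/f(t)$ is increasing in $t$ over all $t$ for which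 the ratio is well defined (here, $t>0$). *)

(* Defs.v *)
From HB Require Import structures.
From mathcomp Require Import all_boot all_order all_algebra.
From mathcomp Require Import all_classical all_reals all_analysis.

Set Implicit Arguments.
Unset Strict Implicit.
Unset Printing Implicit Defensive.

Import Order.TTheory GRing.Theory Num.Theory.
Import numFieldNormedType.Exports.

Local Open Scope classical_set_scope.
Local Open Scope ring_scope.

Definition ordered_psum (R : realType) (n : nat) (x : n.-tuple R) (j : nat) : R :=
  \sum_(i < j) (sort <=%R x)`_i.

Definition majorized (R : realType) (n : nat) (x y : n.-tuple R) : Prop :=
  (forall j : nat, (1 <= j <= n.-1)%N -> ordered_psum x j >= ordered_psum y j)
  /\ ordered_psum x n = ordered_psum y n.

Section random_variables.
Context (R : realType) (d : measure_display) (T : measurableType d).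
Implicit Type P : probability T R.

Definition independent_RV P (X Y : {RV P >-> R}) : Prop :=
  forall A B : set R, measurable A -> measurable B ->
    P (X @^-1` A `&` Y @^-1` B) = (P (X @^-1` A) * P (Y @^-1` B))%E.

Definition has_density P (X : {RV P >-> R}) (f : R -> R) : Prop :=
  [/\ measurable_fun [set: R] f,
      forall t, 0 <= f t &
      forall A : set R, measurable A ->
        distribution P X A = (\int[lebesgue_measure]_(t in A) (f t)%:E)%E].

Definition weibull_pdf (alpha lambda : R) : R -> R :=
  (fun t => alpha * lambda * (lambda * t) `^ (alpha - 1)
            * expR (- (lambda * t) `^ alpha)) \_ `]0, +oo[.

Definition weibull P (X : {RV P >-> R}) (alpha lambda : R) : Prop :=
  has_density X (weibull_pdf alpha lambda).

Definition max_RV P (X Y : {RV P >-> R}) : {RV P >-> R} :=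
  measurable_realfun.max_mfun X Y.

End random_variables.

(* The ratio g / f, with the convention c / 0 = +oo for c > 0; it is well
   defined unless it has the form 0 / 0. *)
Definition density_ratio (R : realType) (f g : R -> R) (t : R) : \bar R :=
  if f t == 0 then +oo%E else (g t / f t)%:E.

(* A density is only determined up to a Lebesgue null set, so the order asks for
   versions of the two densities whose ratio is nondecreasing. *)
Definition lr_le (R : realType) (d d' : measure_display)
    (T : measurableType d) (T' : measurableType d')
    (P : probability T R) (P' : probability T' R)
    (X : {RV P >-> R}) (Y : {RV P' >-> R}) : Prop :=
  exists f g : R -> R, [/\ has_density X f, has_density Y g &
    {in [set t | f t != 0 \/ g t != 0] &,
      nondecreasing_fun (density_ratio f g)}].

(* Main.v *)
(* With s = t^alpha and a_i = lambda_i^alpha, the density of the maximum is,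
   up to a factor depending only on t, the density h of the maximum of two
   exponential variables with rates a_1, a_2.  Since x^alpha is concave,
   majorization of the ordered parameters gives, with b_i = theta_i^alpha,
     b_1 <= a_1 <= a_2 <= b_2  and  b_1 + b_2 <= a_1 + a_2.
   For phi(x) = (e^x - 1) / x, u = a_1 s and v = a_2 s,
     - s h'(s) / h(s) = (u phi(v) + v phi(u) - 2) / (phi(u) + phi(v)).
   This quotient increases in the smaller argument because phi does, and
   decreases when u <= v are spread apart at constant sum because phi >= 1 and
   phi' - phi is nonincreasing.  Hence the ratio of the two densities has a
   nonnegative derivative. *)

Require Import Defs.
From HB Require Import structures.
From mathcomp Require Import all_boot all_order all_algebra.
From mathcomp Require Import ring lra.
From mathcomp Require Import all_classical all_reals all_analysis.
From mathcomp Require Import measurable_realfun.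
Import Order.TTheory GRing.Theory Num.Theory.
Import numFieldNormedType.Exports.
Local Open Scope classical_set_scope.
Local Open Scope ring_scope.

Set Implicit Arguments.
Unset Strict Implicit.

(** * Monotonicity for two exponential rates *)

Lemma is_derive_ge0_le (R : realType) (f f' : R -> R) (a b : R) : a <= b ->
  (forall x, a <= x <= b -> is_derive x 1 f (f' x)) ->
  (forall x, a <= x <= b -> 0 <= f' x) -> f a <= f b.
Proof.
move=> ab df f'0.
have oc x : x \in `]a, b[ -> a <= x <= b.
  by rewrite in_itv/= => /andP[/ltW -> /ltW ->].
apply: (@ger0_derive1_ndecr R f a b) => //.
- by move=> x /oc /df.
- by move=> x /oc xab; have := df _ xab => dfx; rewrite derive1E derive_val f'0.
- apply: derivable_within_continuous => x.
  by rewrite in_itv/= => /df.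
Qed.

Lemma is_derive_div (R : realType) (f g : R -> R) (x df dg : R) : g x != 0 ->
  is_derive x 1 f df -> is_derive x 1 g dg ->
  is_derive x 1 (fun y => f y / g y) ((df * g x - f x * dg) / g x ^+ 2).
Proof.
move=> gx0 dfx dgx; have dgV := is_deriveV gx0 dgx.
have -> : (fun y => f y / g y) = f * (fun y => (g y)^-1) by [].
apply: is_derive_eq; rewrite /GRing.scale/=; field.
by rewrite gx0.
Qed.

Lemma is_derive_expRM (R : realType) (c x : R) :
  is_derive x 1 (fun y => expR (- (c * y))) (- c * expR (- (c * x))).
Proof.
have -> : (fun y => expR (- (c * y))) = expR \o - (c \*: @idfun R) by [].
by apply: is_derive_eq; rewrite /GRing.scale/= mulr1 mulrC.
Qed.

(** * Monotonicity of (e^x - 1) / x and of its second-order analogue *)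

Definition phi (R : realType) (x : R) : R := (expR x - 1) / x.

(** For x > 0 this is the series of x^k / (k + 2)!, and it equals [phi] minus its derivative. *)
Definition phi2 (R : realType) (x : R) : R := (expR x - 1 - x) / x ^+ 2.

Lemma is_derive_phi (R : realType) (x : R) : 0 < x ->
  is_derive x 1 (@phi R) (phi x - phi2 x).
Proof.
move=> x0; have xn0 : x != 0 by rewrite gt_eqF.
have dnum : is_derive x 1 (expR - cst 1) (expR x).
  by apply: is_derive_eq; rewrite subr0.
apply: (is_derive_eq (is_derive_div xn0 dnum (is_derive_id x 1))).
by rewrite /phi /phi2 !fctE/=; field; rewrite xn0.
Qed.

Lemma is_derive_phi2 (R : realType) (x : R) : 0 < x ->
  is_derive x 1 (@phi2 R) (((x - 2) * expR x + x + 2) / x ^+ 3).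
Proof.
move=> x0; have xn0 : x != 0 by rewrite gt_eqF.
have x2n0 : x ^+ 2 != 0 by rewrite expf_neq0.
have dnum : is_derive x 1 (expR - cst 1 - idfun) (expR x - 1).
  by apply: is_derive_eq; rewrite subr0.
have dden : is_derive x 1 (@idfun R ^+ 2) (2 * x).
  by apply: is_derive_eq; rewrite /GRing.scale/= mulr1 expr1.
apply: (is_derive_eq (is_derive_div _ dnum dden)); first exact: x2n0.
by rewrite !fctE/=; field; rewrite xn0.
Qed.

Lemma phi_ge1 (R : realType) (x : R) : 0 < x -> 1 <= phi x.
Proof.
by move=> x0; rewrite ler_pdivlMr// mul1r lerBrDl expR_ge1Dx.
Qed.

(** This is 1 - x <= e^(-x) multiplied by e^x. It yields the sign of the derivative of [phi], and
    later that of [phi2]. *)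
Lemma mul_expR_ge (R : realType) (x : R) : expR x - 1 <= x * expR x.
Proof.
have := expR_ge1Dx (- x); rewrite expRN => h.
have e0 := expR_gt0 x.
have : (1 - x) * expR x <= 1 by rewrite -ler_pdivlMr// div1r.
lra.
Qed.

Lemma phi2_le_phi (R : realType) (x : R) : 0 < x -> phi2 x <= phi x.
Proof.
move=> x0; rewrite /phi2 /phi ler_pdivrMr ?exprn_gt0//.
have := mul_expR_ge x.
rewrite expr2 mulrA divfK ?gt_eqF//; lra.
Qed.

Lemma phi_ndecr (R : realType) (x y : R) : 0 < x -> x <= y -> phi x <= phi y.
Proof.
move=> x0 xy; apply: (@is_derive_ge0_le R _ (fun z => phi z - phi2 z) _ _ xy)
  => z /andP[xz _].
  by apply: is_derive_phi; exact: lt_le_trans xz.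
by rewrite subr_ge0 phi2_le_phi//; exact: lt_le_trans xz.
Qed.

Lemma phi2_ndecr (R : realType) (x y : R) :
  0 < x -> x <= y -> phi2 x <= phi2 y.
Proof.
move=> x0 xy; apply: (@is_derive_ge0_le R _
  (fun z => ((z - 2) * expR z + z + 2) / z ^+ 3) _ _ xy) => z /andP[xz _].
  by apply: is_derive_phi2; exact: lt_le_trans xz.
have z0 : 0 <= z by rewrite ltW// (lt_le_trans x0).
rewrite divr_ge0 ?exprn_ge0//.
(* The numerator of the derivative of [phi2] vanishes at 0 and has the nonnegative derivative t e^t
   - (e^t - 1). *)
pose g (t : R) := (t - 2) * expR t + t + 2.
have -> : 0 = g 0 by rewrite /g expR0; ring.
apply: (@is_derive_ge0_le R g (fun t => t * expR t - (expR t - 1))) => // t _.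
  have -> : g = (idfun - cst 2) * expR + idfun + cst 2 by [].
  by apply: is_derive_eq; rewrite /GRing.scale/= !fctE/=; ring.
by rewrite subr_ge0 mul_expR_ge.
Qed.

(* [phi' = phi - phi2] with [phi2] nondecreasing, so increments of [phi'] are
   dominated by those of [phi]. *)
Lemma phi_second_difference (R : realType) (p v e : R) :
  0 < p -> p <= v -> 0 <= e ->
  phi (v + e) - phi v - (phi (p + e) - phi p) <= e * (phi (v + e) - phi p).
Proof.
move=> p0 pv e0; have v0 := lt_le_trans p0 pv.
pose C := phi (v + e) - phi p.
(* The claim is [g 0 <= g e]. On [0, e] the increment of [phi] from r + p to r + v is at most [C],
   which makes the derivative of [g] nonnegative. *)
pose g r := r * C - (phi (r + v) - phi (r + p)).
suff : g 0 <= g e by rewrite /g /C !add0r (addrC e v) (addrC e p); lra.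
have dshift (w r : R) : 0 < w -> 0 <= r ->
    is_derive r 1 (fun r => phi (r + w)) (phi (r + w) - phi2 (r + w)).
  move=> w0 r0; have rw0 : 0 < r + w by rewrite ltr_wpDl.
  have dphi := is_derive_phi rw0.
  have -> : (fun r => phi (r + w)) = @phi R \o (idfun + cst w) by [].
  by apply: is_derive_eq; rewrite addr0 mulr1.
pose dg r := C - (phi (r + v) - phi2 (r + v) - (phi (r + p) - phi2 (r + p))).
apply: (@is_derive_ge0_le R g dg) e0 _ _ => r /andP[r0 re].
  have dv := dshift _ _ v0 r0; have dp := dshift _ _ p0 r0.
  have -> : g = idfun * cst C
      - ((fun r => phi (r + v)) - (fun r => phi (r + p))) by [].
  by apply: is_derive_eq; rewrite /GRing.scale/= /cst/= /dg; ring.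
have le1 : phi (r + v) <= phi (v + e).
  by apply: phi_ndecr; [rewrite ltr_wpDl|rewrite addrC lerD2l].
have le2 : phi p <= phi (r + p) by apply: phi_ndecr => //; rewrite lerDr.
have le3 : phi2 (r + p) <= phi2 (r + v).
  by apply: phi2_ndecr; [rewrite ltr_wpDl|rewrite lerD2l].
rewrite /dg /C; lra.
Qed.

(* For the maximum of independent exponentials with rates [a] and [b], whose
   density is [max_exp_pdf a b],
   [- h'(s) / h(s) = max_num u v / (s * max_den u v)],
   with [u = a s] and [v = b s]. *)
Definition max_num (R : realType) (u v : R) : R := u * phi v + v * phi u - 2.

Definition max_den (R : realType) (u v : R) : R := phi u + phi v.

Lemma max_den_gt0 (R : realType) (u v : R) : 0 < u -> 0 < v -> 0 < max_den u v.
Proof.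
by move=> /phi_ge1 u1 /phi_ge1 v1; rewrite /max_den; lra.
Qed.

(** Raising the smaller argument raises [max_num / max_den]. The cross-multiplied difference is a
    sum of products of nonnegative factors, because [phi] is nondecreasing and positive. *)
Lemma max_slope_min (R : realType) (w u v : R) : 0 < w -> w <= u -> u <= v ->
  max_num w v * max_den u v <= max_num u v * max_den w v.
Proof.
move=> w0 wu uv; have u0 := lt_le_trans w0 wu.
have := phi_ge1 w0; have := phi_ge1 (lt_le_trans u0 uv).
have := phi_ndecr w0 wu.
rewrite /max_num /max_den.
move: (phi w) (phi u) (phi v) => a b c ab c1 a1.
rewrite -subr_ge0.
have -> : (u * c + v * b - 2) * (a + c) - (w * c + v * a - 2) * (b + c) =
  c * (u - w) * a + (u - w) * c ^+ 2 + (v - w) * c * (b - a) + 2 * (b - a).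
  by ring.
have uw0 : 0 <= u - w by lra.
have vw0 : 0 <= v - w by lra.
have ba0 : 0 <= b - a by lra.
have c0 : 0 <= c by lra.
have a0 : 0 <= a by lra.
by rewrite !addr_ge0 ?mulr_ge0 ?exprn_ge0.
Qed.

(** Spreading (u, v) to (u - e, v + e) lowers [max_num / max_den]. *)
Lemma max_slope_sum (R : realType) (p u v e : R) :
  0 < p -> u = p + e -> 0 <= e -> u <= v ->
  max_num p (v + e) * max_den u v <= max_num u v * max_den p (v + e).
Proof.
move=> p0 -> e0 uv; have u0 : 0 < p + e by rewrite ltr_wpDr.
have v0 := lt_le_trans u0 uv.
have pv : p <= v by rewrite (le_trans _ uv)// lerDl.
have := phi_second_difference p0 pv e0.
have := phi_ge1 u0; have := phi_ge1 v0; have := phi_ge1 p0.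
have pu : p <= p + e by rewrite lerDl.
have := phi_ndecr p0 pu.
have := phi_ndecr u0 uv.
have vq : v <= v + e by rewrite lerDl.
have := phi_ndecr v0 vq.
rewrite /max_num /max_den.
move: (phi p) (phi (p + e)) (phi v) (phi (v + e)) => a b c d.
move=> cd bc ab a1 c1 b1 conv.
rewrite -subr_ge0.
(* The three summands are nonnegative, respectively, by monotonicity of [phi], by [phi >= 1], and by
   [phi_second_difference]. *)
have -> : ((p + e) * c + v * b - 2) * (a + d)
    - (p * d + (v + e) * a - 2) * (b + c) =
  (v - (p + e)) * (d * b - a * c)
  + e * (d - a) * (b + c - 2)
  + 2 * (e * (d - a) - (d - c - (b - a))).
  by ring.
have h1 : 0 <= d * b - a * c.
  have : a * c <= b * d by rewrite ler_pM//; lra.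
  lra.
have h2 : 0 <= v - (p + e) by lra.
have h3 : 0 <= d - a by lra.
have h4 : 0 <= b + c - 2 by lra.
have h5 : 0 <= e * (d - a) - (d - c - (b - a)) by lra.
by rewrite !addr_ge0 ?mulr_ge0.
Qed.

(* Lowering the smaller argument to [p + q - v] and then spreading the pair at
   constant sum both decrease [max_num / max_den]. *)
Lemma max_slope (R : realType) (p q u v : R) :
  0 < p -> p <= u -> u <= v -> v <= q -> p + q <= u + v ->
  max_num p q * max_den u v <= max_num u v * max_den p q.
Proof.
move=> p0 pu uv vq pquv.
pose w := p + q - v; pose e := q - v.
have pw : p <= w by rewrite /w; lra.
have wu : w <= u by rewrite /w; lra.
have w0 := lt_le_trans p0 pw; have u0 := lt_le_trans w0 wu.
have v0 := lt_le_trans u0 uv; have q0 := lt_le_trans v0 vq.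
have we : w = p + e by rewrite /w /e; ring.
have e0 : 0 <= e by rewrite /e; lra.
have := max_slope_sum p0 we e0 (le_trans wu uv).
rewrite (_ : v + e = q); last by rewrite /e; ring.
have := max_slope_min w0 wu uv.
have dwv := max_den_gt0 w0 v0.
have duv := max_den_gt0 u0 v0.
have dpq := max_den_gt0 p0 q0.
(* Cross products are turned back into quotients, which can be chained by transitivity. *)
rewrite -ler_pdivlMr// mulrAC -ler_pdivrMr// => h1.
rewrite -ler_pdivlMr// mulrAC -ler_pdivrMr// => h2.
by rewrite -ler_pdivlMr// mulrAC -ler_pdivrMr// (le_trans h2).
Qed.

(** * Density of the maximum of two exponential variables *)

Definition max_exp_pdf (R : realType) (a b s : R) : R :=
  a * expR (- (a * s)) + b * expR (- (b * s))
  - (a + b) * expR (- ((a + b) * s)).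

Definition max_exp_pdf' (R : realType) (a b s : R) : R :=
  - (a ^+ 2 * expR (- (a * s)) + b ^+ 2 * expR (- (b * s))
  - (a + b) ^+ 2 * expR (- ((a + b) * s))).

Lemma is_derive_max_exp_pdf (R : realType) (a b s : R) :
  is_derive s 1 (max_exp_pdf a b) (max_exp_pdf' a b s).
Proof.
have da := is_derive_expRM a s; have db := is_derive_expRM b s.
have dab := is_derive_expRM (a + b) s.
have -> : max_exp_pdf a b =
  cst a * (fun s => expR (- (a * s))) + cst b * (fun s => expR (- (b * s)))
  - cst (a + b) * (fun s => expR (- ((a + b) * s))) by [].
rewrite /max_exp_pdf'; apply: is_derive_eq.
by rewrite /GRing.scale/= /cst/=; ring.
Qed.

(** Factoring out e^(-(a + b) s) leaves only terms e^x - 1, hence [phi]. The derivative has the same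
    exponential factor, so it cancels in the logarithmic derivative. *)
Lemma max_exp_pdfE (R : realType) (a b s : R) : 0 < a -> 0 < b -> 0 < s ->
  max_exp_pdf a b s =
  a * b * s * expR (- ((a + b) * s)) * max_den (a * s) (b * s).
Proof.
move=> a0 b0 s0; rewrite /max_exp_pdf /max_den /phi.
have ea := expR_gt0 (a * s); have eb := expR_gt0 (b * s).
rewrite (mulrDl a b s) (opprD (a * s)) expRD !expRN.
by field; rewrite !gt_eqF.
Qed.

Lemma max_exp_pdf'E (R : realType) (a b s : R) : 0 < a -> 0 < b -> 0 < s ->
  max_exp_pdf' a b s =
  - (a * b * expR (- ((a + b) * s)) * max_num (a * s) (b * s)).
Proof.
move=> a0 b0 s0; rewrite /max_exp_pdf' /max_num /phi.
have ea := expR_gt0 (a * s); have eb := expR_gt0 (b * s).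
rewrite (mulrDl a b s) (opprD (a * s)) expRD !expRN.
by field; rewrite !gt_eqF.
Qed.

Lemma max_exp_pdf_gt0 (R : realType) (a b s : R) : 0 < a -> 0 < b -> 0 < s ->
  0 < max_exp_pdf a b s.
Proof.
move=> a0 b0 s0; rewrite max_exp_pdfE// !mulr_gt0 ?expR_gt0//.
by rewrite max_den_gt0// mulr_gt0.
Qed.

(** By the two factorizations, the numerator of the derivative of the ratio is a positive factor
    times the difference in [max_slope], taken at the rates multiplied by the current point. *)
Lemma max_exp_pdf_ratio_ndecr (R : realType) (a1 a2 b1 b2 s t : R) :
  0 < b1 -> b1 <= a1 -> a1 <= a2 -> a2 <= b2 -> b1 + b2 <= a1 + a2 ->
  0 < s -> s <= t ->
  max_exp_pdf b1 b2 s / max_exp_pdf a1 a2 s <=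
  max_exp_pdf b1 b2 t / max_exp_pdf a1 a2 t.
Proof.
move=> b10 ba1 a12 ab2 bale s0 st.
have a10 := lt_le_trans b10 ba1; have a20 := lt_le_trans a10 a12.
have b20 := lt_le_trans a20 ab2.
pose dr x := (max_exp_pdf' b1 b2 x * max_exp_pdf a1 a2 x
  - max_exp_pdf b1 b2 x * max_exp_pdf' a1 a2 x) / max_exp_pdf a1 a2 x ^+ 2.
apply: (@is_derive_ge0_le R
  (fun x => max_exp_pdf b1 b2 x / max_exp_pdf a1 a2 x) dr) st _ _
  => x /andP[sx _].
  have an0 : max_exp_pdf a1 a2 x != 0.
    by rewrite gt_eqF// max_exp_pdf_gt0// (lt_le_trans s0).
  exact: is_derive_div an0 (is_derive_max_exp_pdf _ _ _)
    (is_derive_max_exp_pdf _ _ _).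
have x0 := lt_le_trans s0 sx.
rewrite /dr divr_ge0 ?exprn_ge0//; last by rewrite ltW// max_exp_pdf_gt0.
rewrite !max_exp_pdf'E// !max_exp_pdfE//.
have /(_ (b1 * x) (b2 * x) (a1 * x) (a2 * x)) := @max_slope R.
rewrite mulr_gt0// !ler_pM2r// -!mulrDl ler_pM2r// => /(_ isT ba1 a12 ab2 bale).
rewrite -subr_ge0.
set Na := max_num (a1 * x) _; set Nb := max_num (b1 * x) _.
set Da := max_den (a1 * x) _; set Db := max_den (b1 * x) _ => h.
set ea := expR (- ((a1 + a2) * x)); set eb := expR (- ((b1 + b2) * x)).
have -> : - (b1 * b2 * eb * Nb) * (a1 * a2 * x * ea * Da)
    - b1 * b2 * x * eb * Db * - (a1 * a2 * ea * Na) =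
  (b1 * b2 * a1 * a2) * x * ea * eb * (Na * Db - Nb * Da) by ring.
by rewrite !mulr_ge0// ?expR_ge0// ltW.
Qed.

(** * Concavity of x^alpha *)

Lemma powR_bernoulli (R : realType) (z alpha : R) :
  0 <= z -> 0 < alpha -> alpha <= 1 -> z `^ alpha <= 1 + alpha * (z - 1).
Proof.
(* For alpha < 1 this is Young's inequality for z^alpha and 1, with exponents 1 / alpha and 1 / (1 -
   alpha). The case alpha = 1 is separate, as the second exponent would be infinite. *)
move=> z0 al0; rewrite le_eqVlt => /predU1P[->|al1].
  by rewrite powRr1//; lra.
have a0 : 0 < 1 - alpha by lra.
have aI0 : 0 < alpha^-1 by rewrite invr_gt0.
have bI0 : 0 < (1 - alpha)^-1 by rewrite invr_gt0.
have := @conjugate_powR R (z `^ alpha) 1 alpha^-1 (1 - alpha)^-1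
  (powR_ge0 _ _) ler01 aI0 bI0.
rewrite !invrK -powRrM mulfV ?gt_eqF// powRr1// powR1 mulr1 => /(_ _)/le_trans.
by apply; lra.
Qed.

(** Concavity bounds p^alpha by the tangent at u and q^alpha by the tangent at v. The displacements
    p - u and q - v are opposite, and the tangent at v is the flatter one. *)
Lemma powR_sum_le (R : realType) (alpha p q u v : R) :
  0 < alpha -> alpha <= 1 -> 0 < p -> p <= u -> u <= v -> p + q = u + v ->
  p `^ alpha + q `^ alpha <= u `^ alpha + v `^ alpha.
Proof.
move=> al0 al1 p0 pu uv pquv.
have u0 := lt_le_trans p0 pu; have v0 := lt_le_trans u0 uv.
have tangent (x y : R) : 0 < x -> 0 <= y ->
    y `^ alpha <= x `^ alpha + alpha * x `^ (alpha - 1) * (y - x).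
  move=> x0 y0.
  (* The tangent bound is Bernoulli's inequality at y / x, scaled by x^alpha. *)
  have yx0 : 0 <= y / x by rewrite divr_ge0// ltW.
  have xa0 := powR_gt0 alpha x0.
  have := powR_bernoulli yx0 al0 al1.
  rewrite -(ler_pM2l xa0) -powRM ?(ltW x0)// mulrCA divff ?gt_eqF// mulr1.
  move=> /le_trans -> //; rewrite -(mulr_powRB1 (ltW x0) al0).
  rewrite le_eqVlt; apply/orP; left; apply/eqP; field; exact: lt0r_neq0.
have q0 : 0 <= q by lra.
have := tangent _ _ u0 (ltW p0); have := tangent _ _ v0 q0.
have -> : q - v = u - p by lra.
have slope : v `^ (alpha - 1) <= u `^ (alpha - 1).
  have al1' : 0 <= 1 - alpha by rewrite subr_ge0.
  have := ge0_ler_powR al1' (ltW u0) (ltW v0) uv.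
  by rewrite -(opprB 1 alpha) !(powRN _ (1 - alpha)) lef_pV2 ?posrE ?powR_gt0.
have : alpha * v `^ (alpha - 1) * (u - p) <= alpha * u `^ (alpha - 1) * (u - p).
  by rewrite ler_wpM2r ?subr_ge0// ler_pM2l.
lra.
Qed.

(** * Density of the maximum of two Weibull variables *)

(** Fundamental theorem of calculus on a half-line; derivability of [f] supplies its continuity. *)
Lemma ge0_integral_tail (R : realType) (f F : R -> R) (a l : R) :
  (forall x, a <= x -> 0 <= f x) ->
  (forall x, a <= x -> derivable f x 1) ->
  (forall x, a <= x -> is_derive x 1 F (f x)) ->
  F x @[x --> +oo] --> l ->
  (\int[lebesgue_measure]_(x in `[a, +oo[) (f x)%:E = (l - F a)%:E)%E.
Proof.
move=> f0 df dF Fl; rewrite EFinB; apply: ge0_continuous_FTC2y => //.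
- apply: derivable_within_continuous => x.
  by rewrite in_itv/= andbT; exact: df.
- by move=> x /ltW /dF.
- apply: cvg_at_right_filter.
  have [dFa _] := dF a (lexx a).
  exact/differentiable_continuous/derivable1_diffP.
- by move=> x; rewrite in_itv/= andbT => /ltW /dF [_ <-]; rewrite derive1E.
Qed.

Lemma cvg_powRy (R : realType) (alpha : R) :
  0 < alpha -> x `^ alpha @[x --> +oo] --> +oo.
Proof.
move=> al0; apply/cvgryPge => A.
near=> x.
(* The maximum with 0 keeps the base nonnegative, so that raising the threshold to the power alpha
   gives it back. *)
have Ax : Num.max 0 A `^ alpha^-1 <= x.
  by near: x; apply: nbhs_pinfty_ge; exact: num_real.
have B0 : 0 <= Num.max 0 A by rewrite le_max lexx.
have := ge0_ler_powR (ltW al0) (powR_ge0 _ _) (le_trans (powR_ge0 _ _) Ax) Ax.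
rewrite -powRrM mulVf ?gt_eqF// powRr1//; apply: le_trans.
by rewrite le_max lexx orbT.
Unshelve. all: by end_near. Qed.

(** * Tail integrals of Weibull densities *)

Definition weibull_surv (R : realType) (alpha lambda t : R) : R :=
  expR (- (lambda * t) `^ alpha).

(** The formula of [weibull_pdf] without its cutoff at 0, so that differentiation rules apply
    directly. *)
Definition weibull_dens (R : realType) (alpha lambda t : R) : R :=
  alpha * lambda * (lambda * t) `^ (alpha - 1) * weibull_surv alpha lambda t.

Lemma weibull_pdf_gt0E (R : realType) (alpha lambda t : R) : 0 < t ->
  weibull_pdf alpha lambda t = weibull_dens alpha lambda t.
Proof. by move=> t0; rewrite /weibull_pdf patchE mem_set//= in_itv/= t0. Qed.

Lemma weibull_pdf_le0E (R : realType) (alpha lambda t : R) : t <= 0 ->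
  weibull_pdf alpha lambda t = 0.
Proof.
by move=> t0; rewrite /weibull_pdf patchE memNset//= in_itv/= andbT ltNge t0.
Qed.

Lemma weibull_surv_le1 (R : realType) (alpha lambda t : R) :
  weibull_surv alpha lambda t <= 1.
Proof. by rewrite -expR0 ler_expR oppr_le0 powR_ge0. Qed.

Lemma weibull_dens_ge0 (R : realType) (alpha lambda t : R) :
  0 < alpha -> 0 < lambda -> 0 <= weibull_dens alpha lambda t.
Proof.
by move=> al0 la0; rewrite !mulr_ge0 ?powR_ge0 ?expR_ge0// ltW.
Qed.

Lemma is_derive_powRM (R : realType) (lambda p t : R) :
  0 < lambda -> 0 < t ->
  is_derive t 1 (fun x => (lambda * x) `^ p)
    (p * lambda * (lambda * t) `^ (p - 1)).
Proof.
move=> la0 t0.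
have lat : 0 < (lambda \*: @idfun R) t by rewrite mulr_gt0.
have dpow := is_derive1_powR p lat.
have -> : (fun x => (lambda * x) `^ p) =
  (@powR R ^~ p) \o (lambda \*: @idfun R) by [].
by apply: is_derive_eq; rewrite /GRing.scale/=; ring.
Qed.

Lemma is_derive_weibull_surv (R : realType) (alpha lambda t : R) :
  0 < lambda -> 0 < t ->
  is_derive t 1 (weibull_surv alpha lambda) (- weibull_dens alpha lambda t).
Proof.
move=> la0 t0; have dpow := is_derive_powRM alpha la0 t0.
have -> : weibull_surv alpha lambda =
  expR \o - (fun x => (lambda * x) `^ alpha) by [].
apply: is_derive_eq; rewrite /weibull_dens /weibull_surv /=.
by rewrite mulrN mulrC.
Qed.

Lemma derivable_weibull_dens (R : realType) (alpha lambda t : R) :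
  0 < lambda -> 0 < t -> derivable (weibull_dens alpha lambda) t 1.
Proof.
move=> la0 t0; have dpow := is_derive_powRM (alpha - 1) la0 t0.
have dsurv := is_derive_weibull_surv alpha la0 t0.
have -> : weibull_dens alpha lambda =
  cst (alpha * lambda) * (fun x => (lambda * x) `^ (alpha - 1))
  * weibull_surv alpha lambda by [].
exact: ex_derive.
Qed.

Lemma cvg_weibull_survy (R : realType) (alpha lambda : R) :
  0 < alpha -> 0 < lambda -> weibull_surv alpha lambda x @[x --> +oo] --> 0.
Proof.
move=> al0 la0.
have cvM : lambda * x @[x --> +oo] --> +oo by exact: gt0_cvgMry.
exact: cvg_comp (cvg_comp _ _ cvM (cvg_powRy al0)) (@cvgr_expR R).
Qed.

(** The tail starts at a positive point because the density is unbounded near 0 when alpha < 1. *)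
Lemma integral_weibull_tail (R : realType) (alpha lambda a : R) :
  0 < alpha -> 0 < lambda -> 0 < a ->
  (\int[lebesgue_measure]_(t in `[a, +oo[) (weibull_pdf alpha lambda t)%:E =
   (weibull_surv alpha lambda a)%:E)%E.
Proof.
move=> al0 la0 a0.
under eq_integral => t.
  rewrite inE/= in_itv/= andbT => at_.
  rewrite weibull_pdf_gt0E ?(lt_le_trans a0)//.
  over.
rewrite -[weibull_surv _ _ a]opprK -[- - _]sub0r.
apply: (@ge0_integral_tail R (weibull_dens alpha lambda)
  (- weibull_surv alpha lambda)).
- by move=> x _; exact: weibull_dens_ge0.
- by move=> x ax; apply: derivable_weibull_dens => //; exact: lt_le_trans ax.
- move=> x ax; have x0 := lt_le_trans a0 ax.
  have dsurv := is_derive_weibull_surv alpha la0 x0.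
  by apply: is_derive_eq; rewrite opprK.
- by rewrite -oppr0; apply: cvgN; exact: cvg_weibull_survy.
Qed.

(** For t > 0, the product rule applied to the product of the two distribution functions. For t <= 0
    the factors [weibull_pdf] vanish, whatever [weibull_surv] is there. *)
Definition max_weibull_pdf (R : realType) (alpha l1 l2 t : R) : R :=
  weibull_pdf alpha l1 t * (1 - weibull_surv alpha l2 t)
  + weibull_pdf alpha l2 t * (1 - weibull_surv alpha l1 t).

Lemma max_weibull_pdf_le0E (R : realType) (alpha l1 l2 t : R) : t <= 0 ->
  max_weibull_pdf alpha l1 l2 t = 0.
Proof.
move=> t0; rewrite /max_weibull_pdf !(weibull_pdf_le0E _ _ t0).
by move: (weibull_surv alpha l1 t) (weibull_surv alpha l2 t) => x y; ring.
Qed.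

Lemma integral_max_weibull_tail (R : realType) (alpha l1 l2 a : R) :
  0 < alpha -> 0 < l1 -> 0 < l2 -> 0 < a ->
  (\int[lebesgue_measure]_(t in `[a, +oo[) (max_weibull_pdf alpha l1 l2 t)%:E =
   (1 - (1 - weibull_surv alpha l1 a) * (1 - weibull_surv alpha l2 a))%:E)%E.
Proof.
move=> al0 l10 l20 a0.
pose f := weibull_dens alpha l1 * (cst 1 - weibull_surv alpha l2)
  + weibull_dens alpha l2 * (cst 1 - weibull_surv alpha l1).
pose F := (cst 1 - weibull_surv alpha l1) * (cst 1 - weibull_surv alpha l2).
under eq_integral => t.
  rewrite inE/= in_itv/= andbT => at_.
  rewrite /max_weibull_pdf !weibull_pdf_gt0E ?(lt_le_trans a0)//.
  over.
apply: (@ge0_integral_tail R f F).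
- move=> x _.
  change (0 <= weibull_dens alpha l1 x * (1 - weibull_surv alpha l2 x)
    + weibull_dens alpha l2 x * (1 - weibull_surv alpha l1 x)).
  by rewrite addr_ge0// mulr_ge0 ?weibull_dens_ge0// subr_ge0 weibull_surv_le1.
- move=> x ax; have x0 := lt_le_trans a0 ax.
  have dd1 := derivable_weibull_dens (alpha := alpha) l10 x0.
  have dd2 := derivable_weibull_dens (alpha := alpha) l20 x0.
  have [ds1 _] := is_derive_weibull_surv alpha l10 x0.
  have [ds2 _] := is_derive_weibull_surv alpha l20 x0.
  have d1 := derivable_cst (1 : R) x 1.
  exact: derivableD (derivableM dd1 (derivableB d1 ds2))
    (derivableM dd2 (derivableB d1 ds1)).
- move=> x ax; have x0 := lt_le_trans a0 ax.
  have dF l : 0 < l -> is_derive x 1 (cst 1 - weibull_surv alpha l)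
      (weibull_dens alpha l x).
    move=> l0; have ds := is_derive_weibull_surv alpha l0 x0.
    by apply: is_derive_eq; rewrite sub0r opprK.
  apply: (is_derive_eq (is_deriveM (dF _ l10) (dF _ l20))).
  by rewrite addrC; congr (_ + _); exact: mulrC.
- have cv l : 0 < l ->
      (cst 1 - weibull_surv alpha l) x @[x --> +oo] --> (1 : R).
    move=> l0; rewrite -[X in _ --> X](subr0 (1 : R)).
    by apply: cvgB; [exact: cvg_cst|exact: cvg_weibull_survy].
  by rewrite -(mulr1 (1 : R)); apply: cvgM; exact: cv.
Qed.

(** * Measures determined by their tails at positive points *)

Lemma pos_tail_measure (R : realType) (m1 m2 : {measure set R -> \bar R}) :
  (forall a : R, 0 < a -> m1 `[a, +oo[%classic = m2 `[a, +oo[%classic) ->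
  m1 `]0, +oo[%classic = m2 `]0, +oo[%classic.
Proof.
move=> tails; rewrite itvoyEbigcup.
(* The open half-line is the increasing union of these closed tails, so continuity from below
   applies. *)
pose E k : set R := `[0 + k.+1%:R^-1, +oo[%classic.
have cv (m : {measure set R -> \bar R}) :
    (m \o E) x @[x --> \oo] --> m (\bigcup_k E k).
  apply: nondecreasing_cvg_mu.
  - by move=> k; exact: measurable_itv.
  - by apply: bigcup_measurable => k _; exact: measurable_itv.
  - move=> i j ij; apply/subsetPset; apply: subset_itvr.
    by rewrite bnd_simp lerD2l lef_pV2 ?posrE ?ltr0n// ler_nat ltnS.
have := cv m1.
rewrite (_ : m1 \o E = m2 \o E); last first.
  by apply/funext => k /=; apply: tails; rewrite add0r invr_gt0 ltr0n.
by move=> /cvg_lim <- //; have /cvg_lim <- := cv m2.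
Qed.

(** Closed right half-lines form a generating class stable under intersection, so measure uniqueness
    applies. A tail starting at a <= 0 differs from the positive half-line by a null set. *)
Lemma measure_eq_pos_tails (R : realType) (m1 m2 : {measure set R -> \bar R}) :
  (m1 setT < +oo)%E ->
  m1 `]-oo, 0]%classic = 0%E -> m2 `]-oo, 0]%classic = 0%E ->
  (forall a : R, 0 < a -> m1 `[a, +oo[%classic = m2 `[a, +oo[%classic) ->
  forall A, measurable A -> m1 A = m2 A.
Proof.
move=> m1fin m10 m20 tails A mA.
have le0_tail (m : {measure set R -> \bar R}) (a : R) :
    m `]-oo, 0]%classic = 0%E -> a <= 0 ->
    m `[a, +oo[%classic = m `]0, +oo[%classic.
  move=> m0 a0.
  have -> : `[a, +oo[%classic = `]0, +oo[ `|` `[a, 0].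
    by rewrite setUC -itv_bndbnd_setU// bnd_simp.
  apply: measureU0; [exact: measurable_itv|exact: measurable_itv|].
  apply: subset_measure0 m0; [exact: measurable_itv|exact: measurable_itv|].
  exact: subset_itvr.
apply: (measure_unique (@RGenCInfty.G R)
  (fun k => `[- k%:R, +oo[%classic)) => //.
- exact: RGenCInfty.measurableE.
- move=> _ _ [x ->] [y ->]; exists (Num.max x y).
  apply/seteqP; split => z /=; rewrite !in_itv/= !andbT ge_max.
    by move=> [-> ->].
  by move=> /andP.
- by move=> k; exists (- k%:R).
- apply/seteqP; split => // x _; exists (Num.bound `|x|) => //=.
  rewrite in_itv/= andbT lerNl.
  apply/ltW/(le_lt_trans _ (archi_boundP (normr_ge0 x))).
  by rewrite -normrN ler_norm.
- move=> _ [x ->]; have [x0|x0] := leP x 0; last exact: tails.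
  by rewrite !le0_tail//; exact: pos_tail_measure.
- by move=> k; apply: le_lt_trans m1fin; apply: le_measure; rewrite ?inE.
Qed.

(** The proofs [mf] and [f0] are arguments so that the measure structure can be attached to the term
    and inferred from it. *)
Definition density_measure (R : realType) (f : R -> R)
    (mf : measurable_fun [set: R] f) (f0 : forall t, 0 <= f t) (A : set R) :
    \bar R :=
  (\int[lebesgue_measure]_(t in A) (f t)%:E)%E.

Section density_measure.
Context (R : realType) (f : R -> R).
Context (mf : measurable_fun [set: R] f) (f0 : forall t, 0 <= f t).

Let density_measure0 : density_measure mf f0 set0 = 0%E.
Proof. exact: integral_set0. Qed.

Let density_measure_ge0 A : (0 <= density_measure mf f0 A)%E.
Proof. by apply: integral_ge0 => x _; rewrite lee_fin. Qed.

Let density_measure_sigma_additive :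
  semi_sigma_additive (density_measure mf f0).
Proof.
apply: (@semi_sigma_additive_nng_induced _ _ _ lebesgue_measure (EFin \o f));
  first exact/measurable_EFinP.
by move=> x; rewrite lee_fin.
Qed.

HB.instance Definition _ := isMeasure.Build _ _ _ (density_measure mf f0)
  density_measure0 density_measure_ge0 density_measure_sigma_additive.

End density_measure.

Lemma integral_nonpos_eq0 (R : realType) (f : R -> R) :
  (forall t, t <= 0 -> f t = 0) ->
  (\int[lebesgue_measure]_(t in `]-oo, 0%R]) (f t)%:E = 0)%E.
Proof.
by move=> f0; apply: integral0_eq => t; rewrite /= in_itv/= => /f0 ->.
Qed.

(** * Law of the maximum of two independent Weibull variables *)

Section max_weibull.
Context (R : realType) (d : measure_display) (T : measurableType d).
Context (P : probability T R).
Implicit Types X Y : {RV P >-> R}.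

Lemma has_density_pos_tails X (f : R -> R) :
  measurable_fun [set: R] f -> (forall t, 0 <= f t) ->
  (forall t, t <= 0 -> f t = 0) ->
  distribution P X `]-oo, (0 : R)]%classic = 0%E ->
  (forall a : R, 0 < a -> distribution P X `[a, +oo[%classic =
    (\int[lebesgue_measure]_(t in `[a, +oo[) (f t)%:E)%E) ->
  has_density X f.
Proof.
move=> mf f0 fN X0 tails; split => // A mA.
apply: (@measure_eq_pos_tails R (distribution P X)
  (density_measure mf f0)) => //.
- exact: le_lt_trans (probability_le1 (distribution P X) measurableT) (ltry _).
- exact: integral_nonpos_eq0.
Qed.

Lemma measurable_RV_preimage X (i : interval R) :
  measurable (X @^-1` [set` i]).
Proof.
by rewrite -[X in measurable X]setTI; apply: measurable_funP.
Qed.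

Lemma weibull_nonpos_eq0 X (alpha lambda : R) : weibull X alpha lambda ->
  distribution P X `]-oo, (0 : R)]%classic = 0%E.
Proof.
move=> [_ _ ->]; last exact: measurable_itv.
by apply: integral_nonpos_eq0 => t; exact: weibull_pdf_le0E.
Qed.

Lemma weibull_lt X (alpha lambda a : R) :
  0 < alpha -> 0 < lambda -> 0 < a -> weibull X alpha lambda ->
  P (X @^-1` `]-oo, a[) = (1 - weibull_surv alpha lambda a)%:E.
Proof.
move=> al0 la0 a0 [_ _ dX].
have := dX _ (measurable_itv `[a, +oo[).
rewrite integral_weibull_tail// /distribution/= /pushforward => PXa.
rewrite -setCitvr preimage_setC probability_setC.
  by rewrite PXa.
exact: measurable_RV_preimage.
Qed.

(** The maximum is below a exactly when both variables are, so independence gives a product of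
    distribution functions, the complement of the tail integral already computed. *)
Lemma max_weibull_has_density X Y (alpha l1 l2 : R) :
  0 < alpha -> 0 < l1 -> 0 < l2 ->
  weibull X alpha l1 -> weibull Y alpha l2 -> independent_RV X Y ->
  has_density (max_RV X Y) (max_weibull_pdf alpha l1 l2).
Proof.
move=> al0 l10 l20 WX WY XY.
have msurv l : measurable_fun [set: R] (weibull_surv alpha l).
  apply: measurableT_comp => //; apply: measurableT_comp => //.
  by apply: (measurableT_comp (measurable_powR alpha)); exact: measurable_funM.
have [mf1 f10 _] := WX; have [mf2 f20 _] := WY.
have max_lt (a : R) : max_RV X Y @^-1` `]-oo, a[ =
    X @^-1` `]-oo, a[ `&` Y @^-1` `]-oo, a[.
  apply/seteqP; split => w /=; rewrite !in_itv/= gt_max; first by move=> /andP.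
  by move=> [-> ->].
have max_le : max_RV X Y @^-1` `]-oo, 0] `<=` X @^-1` `]-oo, 0].
  by move=> w /=; rewrite !in_itv/= ge_max => /andP[].
apply: has_density_pos_tails.
- have mF l : measurable_fun [set: R] (fun t => 1 - weibull_surv alpha l t).
    by apply: measurable_funB; [exact: measurable_cst|exact: msurv].
  exact: measurable_funD (measurable_funM mf1 (mF l2))
    (measurable_funM mf2 (mF l1)).
- by move=> t; rewrite addr_ge0// mulr_ge0// subr_ge0 weibull_surv_le1.
- exact: max_weibull_pdf_le0E.
- by apply: subset_measure0 max_le (weibull_nonpos_eq0 WX);
    exact: measurable_RV_preimage.
- move=> a a0; rewrite integral_max_weibull_tail//.
  have -> : `[a, +oo[%classic = ~` `]-oo, a[ by rewrite setCitvl.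
  transitivity (1 - P (max_RV X Y @^-1` `]-oo, a[))%E.
    by rewrite -probability_setC//; exact: measurable_RV_preimage.
  rewrite max_lt XY; [|exact: measurable_itv|exact: measurable_itv].
  by rewrite (weibull_lt al0 l10 a0 WX) (weibull_lt al0 l20 a0 WY).
Qed.

End max_weibull.

Lemma max_weibull_pdfC (R : realType) (alpha l1 l2 : R) :
  max_weibull_pdf alpha l1 l2 = max_weibull_pdf alpha l2 l1.
Proof. by apply/funext => t; exact: addrC. Qed.

(** Change of variable s = t^alpha. The prefactor is ds/dt, and it cancels in ratios at the same
    t. *)
Lemma max_weibull_pdfE (R : realType) (alpha l1 l2 t : R) :
  0 < alpha -> 0 < l1 -> 0 < l2 -> 0 < t ->
  max_weibull_pdf alpha l1 l2 t =
  alpha * t^-1 * t `^ alpha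
  * max_exp_pdf (l1 `^ alpha) (l2 `^ alpha) (t `^ alpha).
Proof.
move=> al0 l10 l20 t0; rewrite /max_weibull_pdf !weibull_pdf_gt0E//.
have densE l : 0 < l -> weibull_dens alpha l t =
    alpha * t^-1 * (l `^ alpha * t `^ alpha)
    * expR (- (l `^ alpha * t `^ alpha)).
  move=> l0; rewrite /weibull_dens /weibull_surv -powRM ?ltW//.
  rewrite -(mulr_powRB1 (mulr_ge0 (ltW l0) (ltW t0)) al0).
  by field; rewrite gt_eqF.
rewrite !densE// /weibull_surv !powRM ?ltW// /max_exp_pdf.
rewrite (mulrDl _ _ (t `^ alpha)) opprD expRD.
move: (expR _) (expR _) (t^-1) => e1 e2 u.
by ring.
Qed.

Lemma max_weibull_pdf_gt0 (R : realType) (alpha l1 l2 t : R) :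
  0 < alpha -> 0 < l1 -> 0 < l2 -> 0 < t -> 0 < max_weibull_pdf alpha l1 l2 t.
Proof.
move=> al0 l10 l20 t0; rewrite max_weibull_pdfE//.
rewrite !mulr_gt0 ?invr_gt0 ?powR_gt0//.
by rewrite max_exp_pdf_gt0 ?powR_gt0.
Qed.

(** Reduces to the exponential case with rates raised to the power alpha. Equality of the sums
    becomes the inequality of [powR_sum_le], and t^alpha preserves the order of times. *)
Lemma max_weibull_ratio_ndecr (R : realType) (alpha l1 l2 t1 t2 s t : R) :
  0 < alpha -> alpha <= 1 -> 0 < t1 -> t1 <= l1 -> l1 <= l2 ->
  t1 + t2 = l1 + l2 -> 0 < s -> s <= t ->
  max_weibull_pdf alpha t1 t2 s / max_weibull_pdf alpha l1 l2 s <=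
  max_weibull_pdf alpha t1 t2 t / max_weibull_pdf alpha l1 l2 t.
Proof.
move=> al0 al1 t10 tl1 l12 sumE s0 st.
have l10 := lt_le_trans t10 tl1; have l20 := lt_le_trans l10 l12.
have l2t2 : l2 <= t2 by lra.
have t20 := lt_le_trans l20 l2t2; have t0 := lt_le_trans s0 st.
have ratioE x : 0 < x ->
    max_weibull_pdf alpha t1 t2 x / max_weibull_pdf alpha l1 l2 x =
    max_exp_pdf (t1 `^ alpha) (t2 `^ alpha) (x `^ alpha)
    / max_exp_pdf (l1 `^ alpha) (l2 `^ alpha) (x `^ alpha).
  move=> x0; rewrite !max_weibull_pdfE// -mulf_div divff ?mul1r//.
  by rewrite !mulf_neq0 ?invr_neq0 ?gt_eqF ?powR_gt0.
have powR_le (x y : R) : 0 < x -> x <= y -> x `^ alpha <= y `^ alpha.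
  move=> x0 xy; apply: ge0_ler_powR => //; rewrite ?nnegrE ltW//.
  exact: lt_le_trans xy.
rewrite [leLHS](ratioE _ s0) [leRHS](ratioE _ t0).
exact: (max_exp_pdf_ratio_ndecr (powR_gt0 _ t10) (powR_le _ _ t10 tl1)
  (powR_le _ _ l10 l12) (powR_le _ _ l20 l2t2)
  (powR_sum_le al0 al1 t10 tl1 l12 sumE) (powR_gt0 _ s0) (powR_le _ _ s0 st)).
Qed.

(** * Likelihood ratio order *)

Lemma sort_pair (R : realType) (x y : R) :
  sort <=%R [:: x; y] = [:: Num.min x y; Num.max x y].
Proof.
apply: (sorted_eq le_trans le_anti).
- exact: sort_le_sorted.
- by rewrite /= andbT ge_min !le_max !lexx.
- rewrite perm_sort; case: leP => // _.
  by rewrite (perm_catC [:: x] [:: y]).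
Qed.

Lemma majorized_pair (R : realType) (l1 l2 t1 t2 : R) :
  majorized [tuple l1; l2] [tuple t1; t2] ->
  Num.min t1 t2 <= Num.min l1 l2 /\ t1 + t2 = l1 + l2.
Proof.
(* For n = 2 the only proper partial sum is j = 1, the minimum; the full sorted sum is min + max. *)
move=> [/(_ 1 isT)]; rewrite /ordered_psum !sort_pair !big_ord1.
rewrite !big_ord_recl !big_ord0 /= !addr0 => tl.
by rewrite !addr_min_max => ->.
Qed.

Lemma max_weibull_pdf_sort (R : realType) (alpha l1 l2 : R) :
  max_weibull_pdf alpha (Num.min l1 l2) (Num.max l1 l2) =
  max_weibull_pdf alpha l1 l2.
Proof. by have [_|_] := leP l1 l2; [reflexivity|exact: max_weibull_pdfC]. Qed.

Lemma max_weibull_pdf_neq0 (R : realType) (alpha l1 l2 t : R) :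
  max_weibull_pdf alpha l1 l2 t != 0 -> 0 < t.
Proof.
by rewrite ltNge; apply: contra => t0; rewrite max_weibull_pdf_le0E.
Qed.

Unset Implicit Arguments.
Set Strict Implicit.

Theorem theorem4p4 (R : realType)
  (d : measure_display) (T : measurableType d) (P : probability T R)
  (d' : measure_display) (T' : measurableType d') (P' : probability T' R)
  (alpha lambda1 lambda2 theta1 theta2 : R)
  (Xlambda1 Xlambda2 : {RV P >-> R}) (Xtheta1 Xtheta2 : {RV P' >-> R})
  (lambda1_gt0 : 0 < lambda1) (lambda2_gt0 : 0 < lambda2)
  (theta1_gt0 : 0 < theta1) (theta2_gt0 : 0 < theta2)
  (Wlambda1 : weibull Xlambda1 alpha lambda1)
  (Wlambda2 : weibull Xlambda2 alpha lambda2)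
  (Wtheta1 : weibull Xtheta1 alpha theta1)
  (Wtheta2 : weibull Xtheta2 alpha theta2)
  (indep_lambda : independent_RV Xlambda1 Xlambda2)
  (indep_theta : independent_RV Xtheta1 Xtheta2)
  (alpha_gt0 : 0 < alpha) (alpha_le1 : alpha <= 1) :
  majorized [tuple lambda1; lambda2] [tuple theta1; theta2] ->
  lr_le (max_RV Xlambda1 Xlambda2) (max_RV Xtheta1 Xtheta2).
Proof.
move=> /majorized_pair [min_le sumE].
exists (max_weibull_pdf alpha lambda1 lambda2).
exists (max_weibull_pdf alpha theta1 theta2); split.
- exact: max_weibull_has_density.
- exact: max_weibull_has_density.
(* Both densities vanish for t <= 0, so only positive times are compared. There the denominator is
   positive and the infinite value in [density_ratio] does not arise. *)
- have pos t : t \in [set t | max_weibull_pdf alpha lambda1 lambda2 t != 0 \/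
      max_weibull_pdf alpha theta1 theta2 t != 0] -> 0 < t.
    by rewrite inE => -[] /max_weibull_pdf_neq0.
  move=> s t /pos s0 /pos t0 st.
  have fs := max_weibull_pdf_gt0 alpha_gt0 lambda1_gt0 lambda2_gt0 s0.
  have ft := max_weibull_pdf_gt0 alpha_gt0 lambda1_gt0 lambda2_gt0 t0.
  suff : max_weibull_pdf alpha theta1 theta2 s
      / max_weibull_pdf alpha lambda1 lambda2 s <=
    max_weibull_pdf alpha theta1 theta2 t
      / max_weibull_pdf alpha lambda1 lambda2 t.
    move: fs ft; rewrite /density_ratio.
    move: (max_weibull_pdf alpha lambda1 lambda2) => f fs ft.
    by rewrite !gt_eqF// lee_fin.
  (* The density is symmetric in its parameters, so both pairs may be taken in increasing order. *)
  rewrite -(max_weibull_pdf_sort alpha theta1).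
  rewrite -(max_weibull_pdf_sort alpha lambda1).
  apply: max_weibull_ratio_ndecr => //.
  + by rewrite lt_min theta1_gt0.
  + by rewrite ge_min le_max lexx.
  + by rewrite !addr_min_max.
Qed.
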